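(* Let $p\ge 1$, $n_1,\dots,n_p\geq 1$ and $d_1,\dots,d_p\ge 0$ be integers, and let $f\in\mathbb R[\mathbf x]$, $\mathbf x=(\mathbf x^{(1)},\dots,\mathbf x^{(p)})$ with $\mathbf x^{(i)}=(x^{(i)}_1,\dots,x^{(i)}_{n_i})$, be a multi-form of degree $d_i$ with respect to each group of variables $\mathbf x^{(i)}$, $i=1,\dots,p$. If $f$ is positive on $\Delta_{n_1}\times\dots\times\Delta_{n_p}$, then $$\bigg[\prod_{i=1}^p(\mathbf e^{\mathsf T}\mathbf x^{(i)})^{r_i}\bigg]f(\mathbf x)$$ is a polynomial with positive coefficients for all sufficiently large $r_i$, $i\in\{1,\dots,p\}$; that is, there is a positive integer $N$ such that for all integers $r_1,\dots,r_p\ge N$, the coefficient in this polynomial of every monomial having degree $d_i+r_i$ in $\mathbf x^{(i)}$ for each $i=1,\dots,p$ is positive.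
   Context: A multi-form of degree $d_i$ with respect to each $\mathbf x^{(i)}$ is a real polynomial all of whose monomials have degree exactly $d_i$ in the group of variables $\mathbf x^{(i)}$, for every $i=1,\dots,p$. $\mathbf e$ denotes the all-ones vector of the appropriate dimension, so $\mathbf e^{\mathsf T}\mathbf x^{(i)}=\sum_{j=1}^{n_i}x^{(i)}_j$. $\Delta_n:=\{\mathbf x\in\mathbb R^n_+ : \mathbf e^{\mathsf T}\mathbf x=1\}$ is the standard simplex. *)

(* Defs.v *)
From mathcomp Require Import all_boot all_order all_algebra.
From mathcomp Require Import reals.
From mathcomp Require Import mpoly.

Set Implicit Arguments.
Unset Strict Implicit.
Unset Printing Implicit Defensive.

Import GRing.Theory Num.Theory.
Local Open Scope ring_scope.

(* The variables x^(1), ..., x^(p) are laid out consecutively: the variable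
   x^(i)_j has index [tagnat.Rank i j] in 'I_(\sum_(i < p) n i), and every index
   is of this form. *)

Section MultiForm.

Variables (R : realType) (p : nat) (n : 'I_p -> nat).

Definition group_mdeg (i : 'I_p) (m : 'X_{1..\sum_(i < p) n i}) : nat :=
  (\sum_(j < n i) m (tagnat.Rank i j))%N.

Definition multiform (d : 'I_p -> nat) (f : {mpoly R[\sum_(i < p) n i]}) : Prop :=
  forall m, m \in msupp f -> forall i, group_mdeg i m = d i.

Definition group_sum (i : 'I_p) : {mpoly R[\sum_(i < p) n i]} :=
  \sum_(j < n i) 'X_(tagnat.Rank i j).

End MultiForm.

Definition std_simplex (R : realType) (k : nat) (x : 'rV[R]_k) : Prop :=
  (forall j, 0 <= x 0 j) /\ \sum_(j < k) x 0 j = 1.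

Definition meval_groups (R : realType) (p : nat) (n : 'I_p -> nat)
    (f : {mpoly R[\sum_(i < p) n i]}) (x : forall i, 'rV[R]_(n i)) : R :=
  f.@[fun k => (\mxrow_(i < p) x i) 0 k].

(* Main.v *)
Require Import Defs.
From mathcomp Require Import all_boot all_order all_algebra.
From mathcomp Require Import reals.
From mathcomp Require Import mpoly.
From mathcomp Require Import zify.
From mathcomp Require Import -(notations) boolp classical_sets topology.
From mathcomp Require Import -(notations) normedtype derive realfun.

Set Implicit Arguments.
Unset Strict Implicit.
Unset Printing Implicit Defensive.

Import Order.TTheory GRing.Theory Num.Theory.
Import numFieldNormedType.Exports.
Local Open Scope ring_scope.

(** This is the multi-homogeneous form of Polya's theorem, and the coefficients
    can be computed exactly.  Colour the variables by the group they belong to.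
    The coefficient of x^b in the product of the powers (sum of group i)^(s_i)
    is the product of multinomial coefficients prod_i s_i! / prod_k b_k!
    ([mcoeff_block_pow]).  Multiplying by x^a shifts b to m = a + b, and m! / b!
    is the product of the falling factorials m_k ^_ a_k, so that the coefficient
    of x^m in the product with f = sum_a f_a x^a is, up to the positive factor
    prod_i s_i! / m!, the number

      sum_a f_a prod_k (m_k ^_ a_k)          ([mcoeff_block_powM]).

    Let t_i = d_i + s_i be the degree of x^m in group i and divide by
    prod_i t_i ^ d_i.  Since f has degree d_i in group i, this replaces
    m_k ^_ a_k by m_k ^_ a_k / t^(a_k), which differs from y_k ^ a_k, where
    y_k = m_k / t, by at most a_k^2 / t ([ffact_ratio_bounds]).  The rescaled
    number is therefore f(y) up to C / N, for a constant C depending on f only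
    and N a lower bound of the s_i.  The point y lies in the product of simplices,
    a compact set on which the continuous positive function f is bounded below
    by some c > 0 ([positive_on_simplices_lower_bound]); any N > C / c works
    ([positive_coefs_of_lower_bound]). *)

(** * Powers of the block sums *)

Section GroupedVariables.

Variables (R : comNzRingType) (M : nat) (I : finType) (g : 'I_M -> I).
Implicit Types (k : 'I_M) (i : I) (a b m : 'X_{1..M}).

(** A partition of the variables into blocks is encoded by the colouring [g]
    whose fibres are the blocks: sums and products over all variables then
    range over a plain ['I_M], whatever the layout of the groups. *)
Definition block_deg i m : nat := (\sum_(k | g k == i) m k)%N.

Definition block_sum i : {mpoly R[M]} := \sum_(k | g k == i) 'X_k.

Lemma block_degD i a b : block_deg i (a + b) = (block_deg i a + block_deg i b)%N.
Proof. by rewrite /block_deg -big_split; apply: eq_bigr => j _; rewrite mnmDE. Qed.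

Lemma block_degU i k : block_deg i U_(k) = (g k == i).
Proof.
rewrite /block_deg big_mkcond (bigD1 k) //= [X in (_ + X)%N]big1 => [|j neq_jk].
  by rewrite addn0 mnm1E eqxx; case: eqP.
by rewrite mnm1E [k == j]eq_sym (negbTE neq_jk); case: ifP.
Qed.

Lemma mderiv_block_sum i k : (block_sum i)^`M(k) = (g k == i)%:R.
Proof.
rewrite /block_sum raddf_sum /= [LHS]big_mkcond (bigD1 k) //=.
rewrite [X in _ + X]big1 => [|j neq_jk].
  rewrite addr0 mderivX mnm1E eqxx scale1r.
  rewrite (_ : U_(k) - U_(k) = 0)%MM ?mpolyX0.
    by case: eqP => _ //; rewrite mderiv0.
  by apply/mnmP => l; rewrite mnmBE subnn mnm0E.
by rewrite mderivX mnm1E (negbTE neq_jk) scale0r; case: ifP.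
Qed.

Lemma mderivXn (q : {mpoly R[M]}) e k :
  (q ^+ e.+1)^`M(k) = q ^+ e * q^`M(k) *+ e.+1.
Proof.
elim: e => [|e IHe]; first by rewrite !expr0 !mul1r.
by rewrite exprS mderivM IHe mulrC mulrnAr mulrA -exprS [RHS]mulrS.
Qed.

Definition block_pow (s : I -> nat) : {mpoly R[M]} :=
  \prod_i block_sum i ^+ s i.

(** Only the factor of the block of [k] depends on the variable [k], and it is
    a power of a linear form in which that variable has coefficient 1; hence
    differentiating just lowers one exponent. *)
Lemma mderiv_block_pow (s s' : I -> nat) k :
  (forall i, s' i = (g k == i) + s i)%N ->
  (block_pow s')^`M(k) = block_pow s *+ (s (g k)).+1.
Proof.
move=> s'E; rewrite /block_pow (bigD1 (g k)) //= [in RHS](bigD1 (g k)) //=.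
have rest0 : (\prod_(i | i != g k) block_sum i ^+ s' i)^`M(k) = 0.
  apply: (big_ind (fun q : {mpoly R[M]} => q^`M(k) = 0)).
  - by rewrite -mpolyC1 mderivC.
  - by move=> q1 q2 dq1 dq2; rewrite mderivM dq1 dq2 mul0r mulr0 addr0.
  move=> i neq_ik; case: (s' i) => [|e]; first by rewrite expr0 -mpolyC1 mderivC.
  by rewrite mderivXn mderiv_block_sum eq_sym (negbTE neq_ik) mulr0 mul0rn.
rewrite mderivM rest0 mulr0 addr0 s'E eqxx add1n mderivXn mderiv_block_sum eqxx.
rewrite mulr1 mulrnAl; congr (_ * _ *+ _).
by apply: eq_bigr => i neq_ik; rewrite s'E eq_sym (negbTE neq_ik).
Qed.

(** The multinomial theorem, one block at a time.  Both sides are the iterated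
    derivative of index [m] of the product, which is a constant: induct on the
    degree of [m], using one derivative in a variable occurring in [m]. *)
Lemma mcoeff_block_pow m :
  (block_pow (block_deg^~ m))@_m * (\prod_k (m k)`!)%:R =
  (\prod_i (block_deg i m)`!)%:R.
Proof.
have [e] := ubnP (mdeg m); elim: e m => // e IHe m; rewrite ltnS => le_me.
have [m0|] := eqVneq m 0%MM.
  rewrite {}m0 in le_me *.
  have g0 i : block_deg i (0 : 'X_{1..M})%MM = 0%N.
    by rewrite /block_deg big1 // => k _; rewrite mnm0E.
  rewrite /block_pow big1 => [|i _]; last by rewrite g0.
  rewrite mcoeff1 eqxx mul1r !big1 // => i _; first by rewrite g0.
  by rewrite mnm0E.
rewrite -mdeg_eq0 mdegE sum_nat_eq0 negb_forall => /existsP[k /=].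
rewrite -lt0n => mk_gt0.
have le_Um : (U_(k) <= m)%MM by rewrite lep1mP -lt0n.
pose m' := (m - U_(k))%MM; have mE : m = (m' + U_(k))%MM by rewrite submK.
have := IHe m'; rewrite {IHe} mE mdegD mdeg1 addn1 in le_me * => /(_ le_me).
have gE i : block_deg i (m' + U_(k)) = ((g k == i) + block_deg i m')%N.
  by rewrite block_degD block_degU addnC.
have := congr1 (mcoeff m') (mderiv_block_pow gE).
rewrite mcoeff_mderiv mcoeffMn.
rewrite -[LHS]mulr_natr -[RHS]mulr_natr => dE IHm'.
have -> : (\prod_l ((m' + U_(k))%MM l)`! = (m' k).+1 * \prod_l (m' l)`!)%N.
  rewrite (bigD1 k) //= mnmDE mnm1E eqxx addn1 factS -mulnA [in RHS](bigD1 k) //=.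
  congr (_ * (_ * _))%N; apply: eq_bigr => l neq_lk.
  by rewrite mnmDE mnm1E eq_sym (negbTE neq_lk) addn0.
rewrite natrM mulrA dE mulrAC IHm' -natrM mulnC; congr _%:R.
rewrite (bigD1 (g k)) //= [in RHS](bigD1 (g k)) //= gE eqxx add1n factS mulnA.
congr (_ * _)%N; apply: eq_bigr => i neq_ik.
by rewrite gE eq_sym (negbTE neq_ik).
Qed.

(** When x^a does not divide x^m both sides vanish, the right one because a
    falling factorial [m k ^_ a k] with [m k < a k] does; so no case distinction
    on [a] survives in the formula for the coefficients of a product. *)
Lemma mcoeff_block_powM (s : I -> nat) a m :
  (forall i, block_deg i m = block_deg i a + s i)%N ->
  (block_pow s * 'X_[a])@_m * (\prod_k (m k)`!)%:R =
  (\prod_i (s i)`!)%:R * (\prod_k (m k) ^_ (a k))%:R.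
Proof.
move=> sE; case: (boolP (a <= m)%MM) => [le_am|nle_am].
  have [b mE] : exists b, m = (b + a)%MM by exists (m - a)%MM; rewrite submK.
  rewrite {le_am}mE in sE *.
  have sb i : s i = block_deg i b.
    by apply/eqP; rewrite -(eqn_add2l (block_deg i a)) -sE block_degD addnC.
  have -> : (\prod_k ((b + a)%MM k)`! =
      (\prod_k (b k)`!) * \prod_k ((b + a)%MM k) ^_ (a k))%N.
    rewrite -big_split; apply: eq_bigr => k _ /=.
    by rewrite mnmDE mulnC -[in (b k)`!](addnK (a k) (b k)) ffact_fact ?leq_addl.
  rewrite natrM mulrA [(b + a)%MM]addmC mcoeffMX; congr (_ * _).
  rewrite (_ : block_pow s = block_pow (block_deg^~ b)).
    by rewrite mcoeff_block_pow; congr _%:R; apply: eq_bigr => i _; rewrite sb.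
  by apply: eq_bigr => i _; rewrite sb.
have [k lt_mak] : exists k, (m k < a k)%N.
  apply/existsP; apply: contraR nle_am; rewrite negb_exists => /forallP le_am.
  by apply/mnm_lepP => k; rewrite leqNgt.
rewrite memN_msupp_eq0.
  by rewrite mul0r [in RHS](bigD1 k) //= ffact_small // mul0n mulr0.
rewrite (perm_mem (msuppMX _ _)); apply/mapP => -[b _ mE].
by rewrite mE mnmDE ltnNge leq_addr in lt_mak.
Qed.

End GroupedVariables.

(** * Falling factorials against powers *)

Section RatioBounds.

Variable R : realFieldType.

(** Going from [e] to [e + 1] multiplies the ratio [w] by [(m - e) / t] and the
    power by [m / t]; these factors differ by at most [e / t], so the error grows
    by at most [e / t], and [e ^ 2 + e <= (e + 1) ^ 2].  The truncated difference
    is harmless: it is at most [m], and at least the true one. *)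
Lemma ffact_ratio_bounds (m t e : nat) : (0 < t)%N -> (m <= t)%N ->
  let w : R := (m ^_ e)%:R / t%:R ^+ e in let y : R := (m%:R / t%:R) ^+ e in
  w <= y <= w + (e ^ 2)%:R / t%:R.
Proof.
move=> t_gt0 le_mt /=; have t_gt0R : 0 < t%:R :> R by rewrite ltr0n.
set y := m%:R / t%:R.
have y_ge0 : 0 <= y by rewrite divr_ge0.
have y_le1 : y <= 1 by rewrite ler_pdivrMr // mul1r ler_nat.
elim: e => [|e /andP[le_wy le_yw]]; first by rewrite ffactn0 !expr0 mul0r addr0 divr1 lexx.
set w := (m ^_ e)%:R / _ in le_wy le_yw *.
have w_ge0 : 0 <= w by rewrite divr_ge0 ?exprn_ge0 ?ler0n.
have w_le1 : w <= 1 by rewrite (le_trans le_wy) ?exprn_ile1.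
have -> : (m ^_ e.+1)%:R / t%:R ^+ e.+1 = w * ((m - e)%:R / t%:R) :> R.
  by rewrite ffactnSr natrM exprSr invfM mulrACA.
have le_me : (m - e)%:R / t%:R <= y by rewrite ler_pM2r ?invr_gt0 // ler_nat leq_subr.
have le_em : y <= (m - e)%:R / t%:R + e%:R / t%:R.
  by rewrite -mulrDl ler_pM2r ?invr_gt0 // -natrD ler_nat addnC -leq_subLR.
apply/andP; split; first by rewrite exprSr; apply: ler_pM => //; rewrite divr_ge0.
rewrite exprSr; apply: le_trans (_ : (w + (e ^ 2)%:R / t%:R) * y <= _).
  by rewrite ler_wpM2r.
rewrite mulrDl; apply: le_trans (_ : w * y + (e ^ 2)%:R / t%:R <= _).
  by rewrite lerD2l ler_piMr // divr_ge0.
apply: le_trans (_ : w * ((m - e)%:R / t%:R) + e%:R / t%:R + (e ^ 2)%:R / t%:R <= _).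
  rewrite lerD2r; apply: le_trans (ler_wpM2l w_ge0 le_em) _.
  by rewrite mulrDr lerD2l ler_piMl // divr_ge0.
rewrite -addrA lerD2l -mulrDl ler_pM2r ?invr_gt0 // -natrD ler_nat.
by rewrite -!mulnn; nia.
Qed.

(** Telescoping: factors are replaced one at a time, and the remaining factors
    are at most 1. *)
Lemma prod_difference_bound (J : finType) (w y : J -> R) :
  (forall j, 0 <= w j <= y j) -> (forall j, y j <= 1) ->
  0 <= \prod_j y j - \prod_j w j <= \sum_j (y j - w j).
Proof.
move=> wy y1.
suff [/andP[w0 wle] yle dle] : [/\ 0 <= \prod_j w j <= \prod_j y j, \prod_j y j <= 1
    & \prod_j y j - \prod_j w j <= \sum_j (y j - w j)].
  by rewrite subr_ge0 wle.
elim/big_rec3: _ => [|j d Y W _ [/andP[W0 WY] Y1 dWY]].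
  by rewrite subrr ler01 lexx.
have /andP[wj0 wyj] := wy j; have yj0 := le_trans wj0 wyj; have Y0 := le_trans W0 WY.
split; first by rewrite mulr_ge0 //= ler_pM.
  by rewrite mulr_ile1.
have -> : y j * Y - w j * W = (y j - w j) * Y + w j * (Y - W).
  by rewrite mulrBl mulrBr addrA subrK.
rewrite lerD //; first by rewrite ler_piMr // subr_ge0.
by rewrite (le_trans _ dWY) // ler_piMl ?subr_ge0 // (le_trans wyj).
Qed.

End RatioBounds.

(** * Positivity of the coefficients *)

Lemma prod_grouped (S : comPzSemiRingType) (M : nat) (I : finType) (g : 'I_M -> I)
    (x : I -> S) (a : 'X_{1..M}) :
  \prod_k x (g k) ^+ a k = \prod_i x i ^+ block_deg g i a.
Proof.
rewrite (partition_big g predT) //=; apply: eq_bigr => i _.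
by rewrite -prodrXr; apply: eq_bigr => k /eqP ->.
Qed.

(** The quantitative core: an explicit lower bound of [f] on the product of
    simplices turns into an explicit [N]. *)
Lemma positive_coefs_of_lower_bound (R : archiRealFieldType) (M : nat) (I : finType)
    (g : 'I_M -> I) (d : I -> nat) (f : {mpoly R[M]}) (c : R) :
  0 < c ->
  (forall a, a \in msupp f -> forall i, block_deg g i a = d i) ->
  (forall y : 'I_M -> R, (forall k, 0 <= y k) ->
     (forall i, \sum_(k | g k == i) y k = 1) -> c <= f.@[y]) ->
  exists N : nat, (0 < N)%N /\
    forall s : I -> nat, (forall i, N <= s i)%N ->
    forall m, (forall i, block_deg g i m = d i + s i)%N ->
    0 < (block_pow R g s * f)@_m.
Proof.
move=> c_gt0 fd f_ge.
(* C / N bounds the cost of replacing falling factorials by powers in f. *)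
pose C := \sum_(a <- msupp f) `|f@_a| * \sum_k (a k ^ 2)%:R.
exists (Num.truncn (C / c)).+1; split=> // s le_Ns m md.
set N := (Num.truncn _).+1 in le_Ns.
have lt_CN : C / N%:R < c.
  rewrite ltr_pdivrMr ?ltr0n // mulrC -ltr_pdivrMr //.
  by rewrite truncnS_gt.
pose t i := (d i + s i)%N.
have le_Nt i : (N <= t i)%N by rewrite (leq_trans (le_Ns i)) ?leq_addl.
have t_gt0 i : (0 < t i)%N by exact: leq_trans (le_Nt i).
have t_gt0R i : 0 < (t i)%:R :> R by rewrite ltr0n.
have le_mt k : (m k <= t (g k))%N.
  by rewrite /t -md /block_deg (bigD1 k) //= leq_addr.
pose w k e : R := (m k ^_ e)%:R / (t (g k))%:R ^+ e.
pose y k : R := (m k)%:R / (t (g k))%:R.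
have y_ge0 k : 0 <= y k by rewrite divr_ge0.
have y_le1 k : y k <= 1 by rewrite ler_pdivrMr // mul1r ler_nat.
have c_le_fy : c <= f.@[y].
  apply: f_ge => // i; rewrite (eq_bigr (fun k => (m k)%:R / (t i)%:R)).
    by rewrite -mulr_suml -natr_sum -/(block_deg g i m) md divff // gt_eqF //; apply: t_gt0R.
  by move=> k /eqP <-.
have coefE : (block_pow R g s * f)@_m * (\prod_k (m k)`!)%:R =
    (\prod_i (s i)`!)%:R *
    (\prod_i (t i)%:R ^+ d i * \sum_(a <- msupp f) f@_a * \prod_k w k (a k)).
  rewrite {1}[f]mpolyE [block_pow R g s * _]mulr_sumr raddf_sum /= mulr_suml.
  rewrite 2![in RHS]mulr_sumr.
  apply: eq_big_seq => a fa /=.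
  rewrite -scalerAr mcoeffZ -mulrA mcoeff_block_powM => [|i]; last by rewrite md fd.
  rewrite mulrCA; congr (_ * _); rewrite mulrCA; congr (_ * _).
  rewrite natr_prod prodf_div (prod_grouped g (fun i => (t i)%:R)).
  have -> : \prod_i (t i)%:R ^+ block_deg g i a = \prod_i (t i)%:R ^+ d i :> R.
    by apply: eq_bigr => i _; rewrite fd.
  by rewrite [RHS]mulrC divfK // gt_eqF // prodr_gt0 // => i _; rewrite exprn_gt0.
suff S_gt0 : 0 < \sum_(a <- msupp f) f@_a * \prod_k w k (a k).
  have m_gt0 : 0 < (\prod_k (m k)`!)%:R :> R.
    by rewrite ltr0n prodn_gt0 // => k; rewrite fact_gt0.
  rewrite -(pmulr_lgt0 _ m_gt0) coefE !mulr_gt0 //.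
    by rewrite ltr0n prodn_gt0 // => i; rewrite fact_gt0.
  by rewrite prodr_gt0 // => i _; rewrite exprn_gt0.
rewrite -subr_gt0 in lt_CN; apply: lt_le_trans lt_CN _.
rewrite lerBlDr; apply: le_trans c_le_fy _.
rewrite mevalE -lerBlDl -sumrB /C mulr_suml; apply: ler_sum => a _.
rewrite -mulrBr -mulrA; apply: le_trans (ler_norm _) _; rewrite normrM ler_wpM2l //.
have wyP k := ffact_ratio_bounds R (a k) (t_gt0 (g k)) (le_mt k).
have /andP[D_ge0 D_le] : 0 <= \prod_k y k ^+ a k - \prod_k w k (a k)
    <= \sum_k (y k ^+ a k - w k (a k)).
  apply: prod_difference_bound => k; last by rewrite exprn_ile1.
  by have /andP[-> _] := wyP k; rewrite andbT divr_ge0 ?exprn_ge0.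
rewrite ger0_norm //; apply: le_trans D_le _; rewrite mulr_suml; apply: ler_sum => k _.
have /andP[_ le_yw] := wyP k; rewrite lerBlDl (le_trans le_yw) // lerD2l.
by rewrite ler_wpM2l // lef_pV2 ?posrE ?ltr0n // ler_nat.
Qed.

(** * Variables laid out consecutively *)

(** The indices of colour [i] are exactly the [Rank i j]; this translates sums
    over one group of variables into sums over a fibre of the colouring. *)
Lemma big_Rank (p : nat) (n : 'I_p -> nat) (T : Type) (idx : T)
    (op : Monoid.com_law idx) (i : 'I_p) (F : 'I_(\sum_(i < p) n i) -> T) :
  \big[op/idx]_(j < n i) F (tagnat.Rank i j) =
  \big[op/idx]_(k | tagnat.sig1 k == i) F k.
Proof.
case: (posnP (n i)) => [ni0|ni_gt0].
  have no_j (j : 'I_(n i)) : False by move: (j); rewrite ni0 => -[].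
  rewrite [LHS]big1 => [|j]; last by case: (no_j j).
  rewrite big_pred0 // => k; apply/negP => /eqP ki.
  exact: no_j (cast_ord (congr1 n ki) (tagnat.sig2 k)).
(* The inverse of [Rank i], with a default value off the fibre. *)
pose h k : 'I_(n i) :=
  if tagnat.sig1 k =P i is ReflectT ki then cast_ord (congr1 n ki) (tagnat.sig2 k)
  else Ordinal ni_gt0.
rewrite [RHS](reindex_onto (fun j : 'I_(n i) => tagnat.Rank i j) h) /=.
  apply: eq_bigl => j; rewrite tagnat.Rank1K eqxx /=; apply/esym/eqP/val_inj.
  rewrite /h; case: eqP => [ki|]; last by rewrite tagnat.Rank1K.
  by rewrite tagnat.Rank2K.
move=> k /eqP ki; rewrite /h; case: eqP => // ki'.
by case: _ / ki' => /=; rewrite cast_ord_id tagnat.sig2K.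
Qed.

(** * Compactness of the product of simplices *)

Lemma mpoly_continuous (R : realType) (M : nat) (f : {mpoly R[M]}) :
  continuous (fun v : 'rV[R]_M => f.@[v 0]).
Proof.
have -> : (fun v : 'rV[R]_M => f.@[v 0]) =
    (fun v => \sum_(a <- msupp f) f@_a * \prod_k v 0 k ^+ a k).
  by apply: boolp.funext => v; rewrite mevalE.
apply: continuous_big => [|a _]; first exact: add_continuous.
move=> v; apply: continuousM; first exact: cst_continuous.
move: v; apply: continuous_big => [|k _]; first exact: mul_continuous.
move=> v; apply: (@continuous_comp _ _ _ (fun v : 'rV[R]_M => v 0 k) (fun x => x ^+ a k)).
  exact: coord_continuous.
exact: exprn_continuous.
Qed.

(** The product of simplices is a closed subset of the cube [[0, 1]^M], so [f]
    attains its minimum on it; if there is no such point any [c] will do. *)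
Lemma positive_on_simplices_lower_bound (R : realType) (M : nat) (I : finType)
    (g : 'I_M -> I) (f : {mpoly R[M]}) :
  (forall y : 'I_M -> R, (forall k, 0 <= y k) ->
     (forall i, \sum_(k | g k == i) y k = 1) -> 0 < f.@[y]) ->
  exists2 c : R, 0 < c &
    forall y : 'I_M -> R, (forall k, 0 <= y k) ->
      (forall i, \sum_(k | g k == i) y k = 1) -> c <= f.@[y].
Proof.
move=> f_gt0.
pose K (v : 'rV[R]_M) :=
  (forall k, 0 <= v 0 k) /\ (forall i, \sum_(k | g k == i) v 0 k = 1).
have K_row (y : 'I_M -> R) : (forall k, 0 <= y k) ->
    (forall i, \sum_(k | g k == i) y k = 1) -> K (\row_k y k).
  move=> y_ge0 y_sum; split=> [k|i]; first by rewrite mxE.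
  by rewrite -[RHS](y_sum i); apply: eq_bigr => k _; rewrite mxE.
have K_closed : closed K.
  have -> : K = setI
      (bigcap setT (fun k => preimage (fun v : 'rV[R]_M => v 0 k) (mkset (>= 0))))
      (bigcap setT (fun i => preimage (fun v : 'rV[R]_M => \sum_(k | g k == i) v 0 k)
         (mkset (eq^~ 1)))).
    apply: boolp.funext => v; apply: boolp.propext; split=> [[v_ge0 v_sum]|[v_ge0 v_sum]].
      by split=> [k _|i _]; [exact: v_ge0 | exact: v_sum].
    by split=> [k|i]; [exact: v_ge0 | exact: v_sum].
  apply: closedI; apply: closed_bigI => j _; apply: preimage_closed.
  - by move=> v _; exact: coord_continuous.
  - exact: closed_ge.
  - move=> v _; move: v; apply: continuous_big => [|k _]; first exact: add_continuous.
    exact: coord_continuous.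
  exact: closed_eq.
have K_compact : compact K.
  apply: (subclosed_compact K_closed
    (rV_compact (fun k : 'I_M => @segment_compact R 0 1))) => v [v_ge0 v_sum] k /=.
  rewrite in_itv /= v_ge0 /= -(v_sum (g k)) (bigD1 k) //= lerDl.
  by rewrite sumr_ge0.
have [K0|K0] := boolp.pselect (exists v, K v); last first.
  by exists 1 => // y y_ge0 y_sum; case: K0; exists (\row_k y k); exact: K_row.
have [v] := compact_EVT_min K0 K_compact
  (continuous_subspaceT (@mpoly_continuous R M f)).
rewrite inE => -[v_ge0 v_sum] v_min; exists f.@[v 0]; first exact: f_gt0.
move=> y y_ge0 y_sum.
have := v_min (\row_k y k); rewrite inE => /(_ (K_row y y_ge0 y_sum)) /le_trans; apply.
by rewrite (@meval_eq _ _ _ y) // => k; rewrite mxE.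
Qed.

Theorem proposition3p3 (R : realType) (p : nat) (n d : 'I_p -> nat)
    (f : {mpoly R[\sum_(i < p) n i]}) :
  (1 <= p)%N ->
  (forall i, 1 <= n i)%N ->
  multiform d f ->
  (forall x : forall i, 'rV[R]_(n i),
     (forall i, std_simplex (x i)) -> 0 < meval_groups f x) ->
  exists N : nat, (0 < N)%N /\
    forall r : 'I_p -> nat, (forall i, N <= r i)%N ->
    forall m : 'X_{1..\sum_(i < p) n i},
      (forall i, group_mdeg i m = d i + r i)%N ->
      0 < ((\prod_(i < p) group_sum R n i ^+ r i) * f)@_m.
Proof.
move=> _ _ f_multi f_gt0.
pose g (k : 'I_(\sum_(i < p) n i)) := tagnat.sig1 k.
have block_degE i m : group_mdeg i m = block_deg g i m.
  exact: (big_Rank addn i (fun k => m k)).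
have block_sumE i : group_sum R n i = block_sum R g i.
  exact: (big_Rank +%R i (fun k => 'X_k)).
have [|c c_gt0 f_ge] := @positive_on_simplices_lower_bound R _ _ g f.
  move=> y y_ge0 y_sum.
  have := f_gt0 (fun i => \row_j y (tagnat.Rank i j)); rewrite /meval_groups.
  rewrite (@meval_eq _ _ _ y) => [|k]; last by rewrite !mxE tagnat.sig2K.
  apply=> i; split=> [j|]; first by rewrite mxE.
  rewrite (eq_bigr (fun j => y (tagnat.Rank i j))) => [|j _]; last by rewrite mxE.
  by rewrite (big_Rank +%R i y) y_sum.
have [|N [N_gt0 coef_gt0]] := @positive_coefs_of_lower_bound R _ _ g d f c c_gt0 _ f_ge.
  by move=> a fa i; rewrite -block_degE f_multi.
exists N; split=> // r le_Nr m md.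
rewrite (eq_bigr (fun i => block_sum R g i ^+ r i)) => [|i _]; last by rewrite block_sumE.
by apply: coef_gt0 => // i; rewrite -block_degE md.
Qed.
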